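(* Let $\mathcal H$ be any infinite dimensional Hilbert space. There exist orthogonal projections $Q_1, Q_2, Q_3$ in $\mathcal H$, a sequence $(P_n)_{n\ge 1}$ with $P_n\in\{Q_1,Q_2,Q_3\}$ for every $n\ge 1$, and a vector $x\in\mathcal H$ such that the sequence $(P_n P_{n-1}\cdots P_1 x)_{n\ge 1}$ diverges in norm (i.e. does not converge in the norm of $\mathcal H$). *)

(* Defs.v *)
From HB Require Import structures.
From mathcomp Require Import all_boot all_order all_algebra.
From mathcomp Require Import all_classical all_reals all_analysis.
From mathcomp Require Import complex.

Set Implicit Arguments.
Unset Strict Implicit.
Unset Printing Implicit Defensive.

Import Order.TTheory GRing.Theory Num.Theory.
Import numFieldNormedType.Exports.

Local Open Scope ring_scope.
Local Open Scope classical_set_scope.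

(* A Hilbert space over K is a complete normed K-module H with an inner product
   [ip : {dot H for theta}] satisfying [induces_norm ip], where (K, theta) is
   (R, idfun) in the real case and (R[i], Num.conj) in the complex case.
   [ip] is linear in its first and theta-semilinear in its second argument. *)
Definition induces_norm (K : numFieldType) (theta : K -> K)
    (H : completeNormedModType K) (ip : {dot H for theta}) : Prop :=
  forall u : H, `|u| ^+ 2 = ip u u.

Definition finite_dimensional (K : numFieldType) (H : lmodType K) : Prop :=
  exists (n : nat) (v : 'I_n -> H),
    forall x : H, exists c : 'I_n -> K, x = \sum_(i < n) c i *: v i.

Definition closed_subspace (K : numFieldType) (H : completeNormedModType K)
    (M : set H) : Prop :=
  GRing.submod_closed (mem M) /\ closed M.

Definition orthogonal_projection (K : numFieldType) (theta : K -> K)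
    (H : completeNormedModType K) (ip : {dot H for theta}) (Q : H -> H) : Prop :=
  exists M : set H, closed_subspace M /\
    forall x : H, M (Q x) /\ (forall y : H, M y -> ip (x - Q x) y = 0).

(* [product P n] is the operator P_n P_(n-1) ... P_1; P 0 is never used. *)
Fixpoint product (H : Type) (P : nat -> H -> H) (n : nat) (x : H) : H :=
  if n is m.+1 then P m.+1 (product P m x) else x.

Definition has_divergent_product_of_three_projections
    (K : numFieldType) (theta : K -> K)
    (H : completeNormedModType K) (ip : {dot H for theta}) : Prop :=
  exists Q1 Q2 Q3 : H -> H,
    [/\ orthogonal_projection ip Q1,
        orthogonal_projection ip Q2 &
        orthogonal_projection ip Q3] /\
    exists (P : nat -> H -> H) (x : H),
      (forall n, (1 <= n)%N -> [\/ P n = Q1, P n = Q2 | P n = Q3]) /\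
      ~ cvgn (fun n => product P n.+1 x).

(* Main.v *)
(* Let e_0, e_1, ... be orthonormal.  A unit vector is moved from e_n to e_(n+1)
   with little loss of norm by rotating it in many small steps, each of which
   removes the component along one vector v_t of span(e_n, e_(n+1)).  The point
   is to realise all these steps approximately by words in three projections.

   In a larger space every v_t is the projection of a long vector g_t, the g_t
   being pairwise orthogonal.  Let A project onto a space containing the e_n and
   orthogonal to all g_t - v_t, let B project onto a space containing the e_n
   and the g_t, and let C project onto a slight tilt of the latter, so that BC
   multiplies g_t by some d_t < 1 and fixes what is orthogonal to every g_t.
   On the span of the e_n one gets
     A (BC)^s x = x - \sum_t (1 - d_t^s) / |g_t|^2 <x, v_t> v_t,
   where choosing s decides which t are active (those with d_t^s far from 1).
   If all other active weights near t are negligible with respect to 1/|g_t|^2,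
   then a suitable power of A (BC)^s is close to the projection onto the
   orthogonal complement of v_t.  Only the planes n-1, n, n+1 interact with the
   plane n, so it suffices that the steps of a plane become active in order, with
   rapidly increasing weights, and that even planes precede the adjacent odd
   ones: the lengths |g_t| are then chosen by recursion in one direction and the
   factors d_t by recursion in the other direction. *)

Require Import Defs.
From HB Require Import structures.
From mathcomp Require Import all_boot all_order all_algebra.
From mathcomp Require Import all_classical all_reals all_analysis.
From mathcomp Require Import complex ring.

Set Implicit Arguments.
Unset Strict Implicit.
Unset Printing Implicit Defensive.

Import Order.TTheory GRing.Theory Num.Theory.
Import numFieldNormedType.Exports.

Local Open Scope ring_scope.
Local Open Scope classical_set_scope.

(** * Orthogonal complements and their projections *)

(* Over [R[i]] the inequalities force all [u n] to be real. *)
Definition monotone_cauchy (K : numFieldType) : Prop :=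
  forall u : nat -> K, (forall n, 0 <= u n) -> (forall n, u n.+1 <= u n) ->
  forall e, 0 < e -> exists N, forall m, (N <= m)%N -> `|u N - u m| < e.

(** Otherwise [|x| - n] would be a nonnegative decreasing sequence with unit steps. *)
Lemma monotone_cauchy_archimedean (K : numFieldType) :
  monotone_cauchy K -> forall x : K, exists n : nat, `|x| <= n%:R.
Proof.
move=> mK x; apply: contrapT => /forallNP nx.
have {}nx n : n%:R <= `|x|.
  by have /negP := nx n; rewrite -real_ltNge ?realn ?normr_real// => /ltW.
have [|n|N /(_ N.+1 (leqnSn N))] := mK (fun n => `|x| - n%:R) _ _ 1 ltr01.
- by move=> n; rewrite subr_ge0.
- by rewrite lerD2l lerN2 ler_nat.
- by rewrite (_ : _ - _ = 1) ?normr1 ?ltxx // mulrSr; ring.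
Qed.

Section InnerProduct.
Context {K : numFieldType} {theta : {rmorphism K -> K}}.
Context {H : completeNormedModType K} {ip : {dot H for theta}}.
Hypothesis ip_norm : induces_norm ip.
Implicit Types (x y z : H) (a : K).

Lemma ipC x y : ip x y = theta (ip y x).
Proof. by rewrite hermC mul1r. Qed.

Lemma ipDl x y z : ip (x + y) z = ip x z + ip y z.
Proof. exact: linearDl. Qed.

Lemma ipBl x y z : ip (x - y) z = ip x z - ip y z.
Proof. exact: linearBl. Qed.

Lemma ipZl a x y : ip (a *: x) y = a * ip x y.
Proof. exact: linearZl_LR. Qed.

Lemma ipDr x y z : ip z (x + y) = ip z x + ip z y.
Proof. exact: linearDr. Qed.

Lemma ipBr x y z : ip z (x - y) = ip z x - ip z y.
Proof. exact: linearBr. Qed.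

(** The scalars pulled out this way will be integers or halves of real inner products, so the real
    and complex cases can be treated together. *)
Lemma ipZr a x y : theta a = a -> ip x (a *: y) = a * ip x y.
Proof. by move=> ta; rewrite ipC ipZl rmorphM -ipC ta. Qed.

Lemma ip0l x : ip 0 x = 0. Proof. exact: linear0l. Qed.
Lemma ip0r x : ip x 0 = 0. Proof. exact: linear0r. Qed.

Lemma ip_suml I (r : seq I) (P : pred I) (F : I -> H) y :
  ip (\sum_(i <- r | P i) F i) y = \sum_(i <- r | P i) ip (F i) y.
Proof. exact: linear_sumlz. Qed.

Lemma ip_sumr I (r : seq I) (P : pred I) (F : I -> H) y :
  ip y (\sum_(i <- r | P i) F i) = \sum_(i <- r | P i) ip y (F i).
Proof. exact: linear_sumr. Qed.

Lemma ip_eq0C x y : ip x y = 0 -> ip y x = 0.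
Proof. by move=> xy; rewrite ipC xy rmorph0. Qed.

Lemma ip_self_eq0 x : ip x x = 0 -> x = 0.
Proof. by rewrite -ip_norm => /eqP; rewrite sqrf_eq0 normr_eq0 => /eqP. Qed.

Lemma ip_self_ge0 x : 0 <= ip x x.
Proof. by rewrite -ip_norm exprn_ge0. Qed.

Lemma pythagoras x y : ip x y = 0 -> `|x + y| ^+ 2 = `|x| ^+ 2 + `|y| ^+ 2.
Proof.
move=> xy; rewrite !ip_norm ipDl !ipDr xy (ip_eq0C xy).
by rewrite addr0 add0r.
Qed.

Lemma cauchy_schwarz x y : `|ip x y| <= `|x| * `|y|.
Proof.
have [->|y0] := eqVneq y 0; first by rewrite ip0r !normr0 mulr0.
have ny0 : 0 < `|y| by rewrite normr_gt0.
pose c := ip x y / ip y y.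
have yy0 : ip y y != 0 by rewrite -ip_norm sqrf_eq0 gt_eqF.
have xc : ip (x - c *: y) (c *: y) = 0.
  by apply/ip_eq0C; rewrite ipZl ipC ipBl ipZl divfK // subrr rmorph0 mulr0.
have := pythagoras xc; rewrite subrK normrZ normrM normfV -ip_norm normrX normr_id.
move=> xE; rewrite -(@ler_pXn2r _ 2) ?nnegrE ?mulr_ge0 // exprMn xE.
have -> : (`|ip x y| / `|y| ^+ 2 * `|y|) ^+ 2 = `|ip x y| ^+ 2 / `|y| ^+ 2.
  by field; rewrite gt_eqF.
by rewrite mulrDl divfK ?sqrf_eq0 ?gt_eqF // lerDr mulr_ge0 ?exprn_ge0.
Qed.

Definition annihilates (I : Type) (f : I -> H) x := forall i, ip x (f i) = 0.

(** A projection is specified by a family that it kills: its range is then cut out by equations, and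
    its linearity follows from uniqueness. *)
Definition perp_proj (I : Type) (f : I -> H) (Q : H -> H) :=
  forall x, annihilates f (Q x) /\
    forall y, annihilates f y -> ip (x - Q x) y = 0.

Section PerpProjTheory.
Context {I : Type} {f : I -> H} {Q : H -> H}.
Hypothesis projQ : perp_proj f Q.

Lemma annihilatesB x y : annihilates f x -> annihilates f y ->
  annihilates f (x - y).
Proof. by move=> fx fy i; rewrite ipBl fx fy subrr. Qed.

Lemma annihilatesD x y : annihilates f x -> annihilates f y ->
  annihilates f (x + y).
Proof. by move=> fx fy i; rewrite ipDl fx fy addr0. Qed.

Lemma annihilatesZ a x : annihilates f x -> annihilates f (a *: x).
Proof. by move=> fx i; rewrite ipZl fx mulr0. Qed.

(** [Q x - y] lies in the complement of [f] and is a difference of two vectors orthogonal to that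
    complement, hence is orthogonal to itself. *)
Lemma perp_proj_unique x y : annihilates f y ->
  (forall z, annihilates f z -> ip (x - y) z = 0) -> Q x = y.
Proof.
move=> fy xy; have [fQ xQ] := projQ x.
have fd : annihilates f (Q x - y) by exact: annihilatesB.
apply/eqP; rewrite -subr_eq0; apply/eqP/ip_self_eq0.
have {1}-> : Q x - y = (x - y) - (x - Q x) by rewrite opprB [RHS]addrC addrA subrK.
by rewrite ipBl xy // xQ // subrr.
Qed.

Lemma perp_proj_id x : annihilates f x -> Q x = x.
Proof. by move=> fx; apply: perp_proj_unique => // z _; rewrite subrr ip0l. Qed.

Lemma perp_proj0 i : Q (f i) = 0.
Proof.
apply: perp_proj_unique; first by move=> j; rewrite ip0l.
by move=> z fz; rewrite subr0; apply: ip_eq0C.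
Qed.

Lemma perp_projD x y : Q (x + y) = Q x + Q y.
Proof.
have [[fx xQ] [fy yQ]] := (projQ x, projQ y).
apply: perp_proj_unique; first exact: annihilatesD.
by move=> z fz; rewrite opprD addrACA ipDl xQ // yQ // addr0.
Qed.

Lemma perp_projZ a x : Q (a *: x) = a *: Q x.
Proof.
have [fx xQ] := projQ x; apply: perp_proj_unique; first exact: annihilatesZ.
by move=> z fz; rewrite -scalerBr ipZl xQ // mulr0.
Qed.

Lemma perp_projB x y : Q (x - y) = Q x - Q y.
Proof. by rewrite -scaleN1r perp_projD perp_projZ scaleN1r. Qed.

Lemma perp_proj_le x : `|Q x| <= `|x|.
Proof.
have [fx xQ] := projQ x.
rewrite -(@ler_pXn2r _ 2) ?nnegrE // -[X in _ <= `|X| ^+ 2](subrK (Q x)).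
by rewrite pythagoras ?xQ // lerDr exprn_ge0.
Qed.

Lemma perp_proj_orthogonal_projection : orthogonal_projection ip Q.
Proof.
exists (annihilates f); split; last first.
  by move=> x; have [fQ xQ] := projQ x.
split.
  split => [|a x y fx fy].
    by apply/mem_set => i; rewrite ip0l.
  by apply/mem_set/annihilatesD; [apply/annihilatesZ/set_mem|apply/set_mem].
(* Closedness: compare [x] with a nearby [y] in the range by Cauchy-Schwarz; the [+ 1] below covers
   [f i = 0]. *)
move=> x cx i; apply/eqP; rewrite -normr_le0.
apply/ler_addgt0Pr => e e0; rewrite add0r.
have d0 : 0 < e / (`|f i| + 1) by rewrite divr_gt0 // ltr_wpDl.
have [y [fy]] := cx _ (nbhsx_ballx x _ d0).
rewrite -ball_normE /= => xy.
rewrite -[ip x _]subr0 -(fy i) -ipBl (le_trans (cauchy_schwarz _ _)) //.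
rewrite (le_trans (ler_wpM2r (normr_ge0 _) (ltW xy))) // mulrAC.
by rewrite ler_pdivrMr ?ltr_wpDl // ler_wpM2l ?(ltW e0) // lerDl.
Qed.

End PerpProjTheory.

(* This is [x] itself when [w = 0], since then [ip x w / ip w w = 0]. *)
Definition reject x w := x - (ip x w / ip w w) *: w.

Lemma reject_orth x w : ip (reject x w) w = 0.
Proof.
rewrite ipBl ipZl; have [w0|w0] := eqVneq (ip w w) 0; last by rewrite divfK // subrr.
by rewrite (ip_self_eq0 w0) !ip0r mulr0 subrr.
Qed.

Lemma norm_component x w : `|(ip x w / ip w w) *: w| <= `|x|.
Proof.
have [->|w0] := eqVneq w 0; first by rewrite scaler0 normr0.
have nw0 : 0 < `|w| by rewrite normr_gt0.
rewrite normrZ normrM normfV -ip_norm normrX normr_id.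
rewrite (_ : _ * _ = `|ip x w| / `|w|); last by field; rewrite gt_eqF.
by rewrite ler_pdivrMr // cauchy_schwarz.
Qed.

Lemma norm_reject x w : `|reject x w| <= `|x|.
Proof.
rewrite -(@ler_pXn2r _ 2) ?nnegrE //.
have := pythagoras (x := reject x w) (y := (ip x w / ip w w) *: w).
rewrite subrK => ->; first by rewrite lerDl exprn_ge0.
by apply: ip_eq0C; rewrite ipZl (ip_eq0C (reject_orth x w)) mulr0.
Qed.

End InnerProduct.

Arguments annihilates {K theta H} ip {I} f x.
Arguments perp_proj {K theta H} ip {I} f Q.
Arguments reject {K theta H} ip x w.

(** * Existence of projections and of an orthonormal sequence *)

Section PerpProjExistence.
Context {K : numFieldType} {theta : {rmorphism K -> K}}.
Context {H : completeNormedModType K} {ip : {dot H for theta}}.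
Hypothesis ip_norm : induces_norm ip.
Hypothesis mcK : monotone_cauchy K.

Lemma ip_limit (r : nat -> H) (l y : H) (c : K) (N : nat) :
  r @ \oo --> l -> (forall n, (N <= n)%N -> ip (r n) y = c) -> ip l y = c.
Proof.
move=> rl rc; apply/eqP; rewrite -subr_eq0 -normr_le0.
apply/ler_addgt0Pr => e e0; rewrite add0r.
have d0 : 0 < e / (`|y| + 1) by rewrite divr_gt0 // ltr_wpDl.
have [M _ rM] := (cvgrPdist_lt r l).1 rl _ d0.
have /ltW lM := rM (maxn M N) (leq_maxl _ _).
rewrite -(rc (maxn M N) (leq_maxr _ _)) -ipBl.
rewrite (le_trans (cauchy_schwarz ip_norm _ _)) //.
rewrite (le_trans (ler_wpM2r (normr_ge0 _) lM)) // mulrAC.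
by rewrite ler_pdivrMr ?ltr_wpDl // ler_wpM2l ?(ltW e0) // lerDl.
Qed.

Section Sequence.
Variable f : nat -> H.
Hypothesis f_orth : forall m n, m != n -> ip (f m) (f n) = 0.
Variable x : H.

Let c i := ip x (f i) / ip (f i) (f i).
Let r n := x - \sum_(i < n) c i *: f i.

Let r_orth n i : (i < n)%N -> ip (r n) (f i) = 0.
Proof.
move=> ltin; rewrite ipBl ip_suml (bigD1 (Ordinal ltin)) //= big1 => [|j jNi].
  rewrite ipZl addr0 /c.
  have [fi0|fi0] := eqVneq (ip (f i) (f i)) 0; last by rewrite divfK // subrr.
  by rewrite (ip_self_eq0 ip_norm fi0) !ip0r mulr0 subrr.
by rewrite ipZl (f_orth (n := i)) ?mulr0.
Qed.

Let r_diff m n : (n <= m)%N -> `|r n| ^+ 2 = `|r m| ^+ 2 + `|r n - r m| ^+ 2.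
Proof.
move=> lenm; rewrite -(pythagoras ip_norm) ?subrKC //.
have -> : r n - r m = \sum_(n <= i < m) c i *: f i.
  rewrite /r opprB addrC addrA subrK -!(big_mkord predT (fun i => c i *: f i)).
  by rewrite (big_cat_nat (leq0n n) lenm) /= [X in X - _]addrC addrK.
rewrite ip_sumr big_nat big1 // => i /andP[_ ltim].
by apply: ip_eq0C; rewrite ipZl (ip_eq0C (r_orth ltim)) mulr0.
Qed.

(** [y] is the limit of the residuals [r n]. By [r_diff] their squared norms decrease and control
    the squared distances between them, so [monotone_cauchy] makes the residuals a Cauchy
    sequence. *)
Lemma orthogonal_expansion : exists y, annihilates ip f y /\
  forall z, annihilates ip f z -> ip (x - y) z = 0.
Proof.
have r_cvg : cvgn r.
  apply/cauchy_cvgP/cauchy_exP => e e0.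
  have [|n|N rN] := mcK (u := fun n => `|r n| ^+ 2) _ _ (exprn_gt0 2 e0).
  - by move=> n; rewrite exprn_ge0.
  - by rewrite (r_diff (leqnSn n)) lerDl exprn_ge0.
  exists (r N), N => // m /= leNm.
  rewrite -ball_normE /= -(@ltr_pXn2r _ 2) ?nnegrE ?(ltW e0) //.
  have := rN m leNm; rewrite (r_diff leNm) [_ + _ - _]addrAC subrr add0r.
  by rewrite ger0_norm // exprn_ge0.
move/cvg_ex : r_cvg => [l rl]; exists l; split=> [i|z fz].
  by apply: (ip_limit (N := i.+1) rl) => n; apply: r_orth.
apply/eqP; rewrite ipBl subr_eq0 eq_sym; apply/eqP.
apply: (ip_limit (N := 0) rl) => n _.
rewrite ipBl ip_suml big1 ?subr0 // => i _.
by rewrite ipZl (ip_eq0C (fz i)) mulr0.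
Qed.

End Sequence.

Lemma perp_proj_exists (T : countType) (f : T -> H) :
  (forall s t, s != t -> ip (f s) (f t) = 0) ->
  exists Q, perp_proj ip f Q.
Proof.
(* Numbers that code no element of [T] get the vector 0, which imposes no condition. *)
move=> f_orth; pose f' n := if @pickle_inv T n is Some t then f t else 0.
have f'_orth m n : m != n -> ip (f' m) (f' n) = 0.
  rewrite /f'; case Em: pickle_inv => [s|]; last by rewrite ip0l.
  case En: pickle_inv => [t|]; last by rewrite ip0r.
  move=> mn; apply: f_orth; apply: contra_neq mn => st.
  by move: (@pickle_invK T m) (@pickle_invK T n); rewrite Em En st /= => <- <-.
have f'E y : annihilates ip f' y <-> annihilates ip f y.
  split=> fy n; first by have := fy (pickle n); rewrite /f' pickleK_inv.
  by rewrite /f'; case: pickle_inv => // ; rewrite ip0r.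
have /choice[Q QP] x := orthogonal_expansion f'_orth x.
exists Q => x; have [fQ xQ] := QP x.
by split=> [|y /f'E]; [apply/f'E|apply: xQ].
Qed.

Lemma orthonormal_sequence : ~ finite_dimensional H ->
  exists E : nat -> H, forall m n, ip (E m) (E n) = (m == n)%:R.
Proof.
move=> infH.
(* Gram-Schmidt by choice, with default 0; infinite dimension guarantees that the set is inhabited
   for every [s = F n]. *)
pose next (s : seq H) := xget 0 [set x | ip x x = 1 /\ all (fun y => ip x y == 0) s].
pose F n := iter n (fun s => rcons s (next s)) [::].
pose E n := next (F n).
have FE n : F n = mkseq E n.
  by elim: n => // n IHn; rewrite mkseqS -IHn.
have EP n : ip (E n) (E n) = 1 /\ forall i, (i < n)%N -> ip (E n) (E i) = 0.
  elim/ltn_ind: n => n IHn.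
  have Eorth i j : (i < n)%N -> (j < n)%N -> ip (E i) (E j) = (i == j)%:R.
    move=> ltin ltjn; case: ltngtP => [ij|ji|->].
    - by apply: ip_eq0C; have [_] := IHn j ltjn; apply.
    - by have [_] := IHn i ltin; apply.
    - by have [] := IHn j ltjn.
  have [x xN] : exists x, forall c : 'I_n -> K, x != \sum_(i < n) c i *: E i.
    apply: contrapT => /forallNP nx; apply: infH; exists n, (fun i => E i) => x.
    have /existsNP[c] := nx x; move/negP; rewrite negbK => /eqP xc.
    by exists c.
  pose y := x - \sum_(i < n) ip x (E i) *: E i.
  have y0 : y != 0 by rewrite subr_eq0 xN.
  have yE i : (i < n)%N -> ip y (E i) = 0.
    move=> ltin; rewrite ipBl ip_suml (bigD1 (Ordinal ltin)) //= big1 => [|j jNi].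
      by rewrite ipZl Eorth // eqxx mulr1 addr0 subrr.
    by rewrite ipZl Eorth // -[_ == i]/(j == Ordinal ltin) (negbTE jNi) mulr0.
  have ny0 : `|y| != 0 by rewrite normr_eq0.
  have [] : [set x | ip x x = 1 /\ all (fun y => ip x y == 0) (F n)] (E n).
    apply: xgetPex; exists (`|y|^-1 *: y); split.
      by rewrite -ip_norm normrZ normfV normr_id mulVf // expr1n.
    rewrite FE all_map; apply/allP => i; rewrite mem_iota => /andP[_ ltin] /=.
    by rewrite ipZl yE // mulr0.
  rewrite FE all_map => E1 /allP E0; split=> // i ltin.
  by apply/eqP/E0; rewrite mem_iota.
exists E => m n; case: ltngtP => [mn|nm|->].
- by apply: ip_eq0C; have [_] := EP n; apply.
- by have [_] := EP m; apply.
- by have [] := EP n.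
Qed.

End PerpProjExistence.

(** * Powers approximating the removal of a component *)

Section Bernoulli.
Context {K : numFieldType}.
Implicit Types (c d : K) (r : nat).

(** A division-free bound by [1 / (1 + r c)]: many small reductions kill a component. Conversely
    [bernoulli_growth] shows that few of them leave it nearly intact. *)
Lemma bernoulli_decay c r : 0 <= c <= 1 -> (1 - c) ^+ r * (1 + r%:R * c) <= 1.
Proof.
move=> /andP[c0 c1]; elim: r => [|r IHr]; first by rewrite expr0 mul0r addr0 mulr1.
apply: le_trans IHr; rewrite exprSr -mulrA ler_wpM2l ?exprn_ge0 ?subr_ge0 //.
rewrite -subr_ge0 (_ : _ - _ = r.+1%:R * c ^+ 2) ?mulr_ge0 ?exprn_ge0 //.
by rewrite mulrSr; ring.
Qed.

Lemma bernoulli_growth d r : 0 <= d <= 1 -> 1 - d ^+ r <= r%:R * (1 - d).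
Proof.
move=> /andP[d0 d1]; elim: r => [|r IHr]; first by rewrite expr0 subrr mul0r.
rewrite (_ : 1 - _ = d * (1 - d ^+ r) + (1 - d)); last by rewrite exprS; ring.
rewrite mulrSr mulrDl mul1r lerD2r (le_trans _ IHr) //.
by rewrite ler_piMl // subr_ge0 exprn_ile1.
Qed.

End Bernoulli.

Section ApproximatePower.
Context {K : numFieldType} {theta : {rmorphism K -> K}}.
Context {H : completeNormedModType K} {ip : {dot H for theta}}.
Hypothesis ip_norm : induces_norm ip.
Variables (F : H -> H) (v : H) (gamma delta : K) (D : H -> Prop).
Hypothesis F_sub : forall x y, F (x - y) = F x - F y.
Hypothesis F_le : forall x, `|F x| <= `|x|.
Hypothesis v0 : v != 0.
Hypothesis gammaP : 0 <= gamma * ip v v <= 1.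
Hypothesis delta_ge0 : 0 <= delta.
Hypothesis D_stable : forall x a, D x -> D (x + a *: v).
Hypothesis F_approx : forall x, D x ->
  `|F x - (x - (gamma * ip x v) *: v)| <= delta * `|x|.

Let G x := x - (gamma * ip x v) *: v.
Let c := gamma * ip v v.
Let vv0 : ip v v != 0. Proof. by rewrite -ip_norm sqrf_eq0 normr_eq0. Qed.

Let norm_G x : `|G x| <= `|x|.
Proof.
have /andP[c0 c1] : 0 <= c <= 1 := gammaP.
(* [G] is a convex combination of two contractions, the identity and the rejection. *)
have -> : G x = (1 - c) *: x + c *: reject ip x v.
  rewrite /reject scalerBr scalerA addrA -scalerDl subrK scale1r /G /c.
  by congr (_ - _ *: _); field.
rewrite (le_trans (ler_normD _ _)) // (normrZ (1 - c)) (normrZ c) (ger0_norm c0).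
rewrite ger0_norm ?subr_ge0 //.
rewrite -[leRHS]mul1r -[X in _ <= X * _](subrK c) [leRHS]mulrDl lerD2l.
by rewrite ler_wpM2l // (norm_reject ip_norm).
Qed.

Let iter_G r x : iter r G x = x - ((1 - (1 - c) ^+ r) / ip v v * ip x v) *: v.
Proof.
elim: r => [|r /= ->]; first by rewrite expr0 subrr !mul0r scale0r subr0.
rewrite {1}/G ipBl ipZl -addrA -opprD -scalerDl; congr (_ - _ *: _).
by rewrite exprS /c; field.
Qed.

(** [G] multiplies the component along [v] by [1 - c] and fixes its complement, which gives the
    second error term. Since [F] is additive and contracting, replacing [r] factors [G] by [F] costs
    [delta] each; only the iterates of [G] have to stay in [D]. *)
Lemma approximate_power r x : D x ->
  `|iter r F x - reject ip x v| <= (r%:R * delta + (1 - c) ^+ r) * `|x|.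
Proof.
have /andP[c0 c1] : 0 <= c <= 1 := gammaP.
move=> Dx; rewrite -(subrK (iter r G x) (iter r F x)) -addrA.
rewrite (le_trans (ler_normD _ _)) // mulrDl lerD //.
  have DG i : D (iter i G x) by rewrite iter_G -scaleNr; apply: D_stable.
  have nG i : `|iter i G x| <= `|x| by elim: i => //= i; apply: le_trans.
  elim: r => [|r IHr]; first by rewrite subrr normr0 !mul0r.
  rewrite !iterS -(subrK (F (iter r G x)) (F _)) -addrA (le_trans (ler_normD _ _)) //.
  rewrite -F_sub mulrSr !mulrDl mul1r lerD ?(le_trans (F_le _)) //.
  by rewrite (le_trans (F_approx (DG r))) // ler_wpM2l.
have -> : iter r G x - reject ip x v = (1 - c) ^+ r *: ((ip x v / ip v v) *: v).
  rewrite iter_G /reject opprB addrC addrA subrK -scalerBl scalerA.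
  by congr (_ *: _); field.
rewrite normrZ ger0_norm ?exprn_ge0 ?subr_ge0 //.
by rewrite ler_wpM2l ?exprn_ge0 ?subr_ge0 ?(norm_component ip_norm).
Qed.

End ApproximatePower.

(** * Dilation to three projections *)

Section Dilation.
Context {K : numFieldType} {theta : {rmorphism K -> K}}.
Context {H : completeNormedModType K} {ip : {dot H for theta}}.
Hypothesis ip_norm : induces_norm ip.
Context {T : countType}.

Variable b : (T * T) + (T + T) -> H.
Hypothesis b_orth : forall i j, ip (b i) (b j) = (i == j)%:R.
Variables (v : T -> H) (U : T -> seq T).
Hypothesis v_b : forall t i, ip (v t) (b i) = 0.
Hypothesis v_real : forall s t, ip (v s) (v t) = ip (v t) (v s).
Hypothesis U_uniq : forall t, uniq (U t).
Hypothesis U_orth : forall s t, s != t -> t \notin U s -> ip (v s) (v t) = 0.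
Variables L sigma : T -> nat.
Hypothesis L_gt1 : forall t, (1 < L t)%N.
Let L_gt0 t : (0 < L t)%N. Proof. exact: ltnW. Qed.

(** Auxiliary directions: [p] makes the lifts orthogonal, [h] makes them long, and [k] serves to
    tilt them. *)
Let p s t := b (inl (s, t)).
Let h t := b (inr (inl t)).
Let k t := b (inr (inr t)).

(* The vectors [p t u] and [p u t] are used only by [t] and [u]; they contribute
   minus [ip (v t) (v u)] to the inner product of the lifts of [v t] and [v u]. *)
Definition correction t : H :=
  \sum_(u <- U t) (p t u - (ip (v t) (v u) / 2) *: p u t).
Definition lift_tail t : H := (L t)%:R *: h t + correction t.
Definition lift t : H := v t + lift_tail t.
(** This is [lift_norm2 t - L t ^ 2]. It does not depend on [L], so a bound for it can be fixed
    before [L] is chosen. *)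
Definition lift_slack t : K := ip (v t + correction t) (v t + correction t).
Definition lift_norm2 t : K := ip (lift t) (lift t).

Let c s t := ip (v s) (v t) / 2.

Let theta_c s t : theta (c s t) = c s t.
Proof. by rewrite /c rmorphM /= fmorphV /= rmorph_nat -ipC -v_real. Qed.

Let correction_h t s : ip (correction t) (h s) = 0.
Proof.
rewrite ip_suml big1 // => u _; rewrite ipBl ipZl !b_orth.
by rewrite mulr0 subrr.
Qed.

Let correction_k t s : ip (correction t) (k s) = 0.
Proof.
rewrite ip_suml big1 // => u _; rewrite ipBl ipZl !b_orth.
by rewrite mulr0 subrr.
Qed.

Let sum_U t u (F : T -> K) :
  \sum_(w <- U t) (w == u)%:R * F w = (u \in U t)%:R * F u.
Proof.
have [utn|utn] := boolP (u \in U t).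
  rewrite (bigD1_seq u) //= eqxx mul1r big1 ?addr0 // => w /negbTE ->.
  by rewrite mul0r.
rewrite mul0r big_seq big1 // => w wt.
by rewrite (_ : w == u = false) ?mul0r //; apply: contraNF utn => /eqP <-.
Qed.

Let correction_p t s u : ip (correction t) (p s u) =
  (t == s)%:R * (u \in U t)%:R - (t == u)%:R * ((s \in U t)%:R * c t s).
Proof.
rewrite ip_suml -(sum_U t s (c t)) -[(u \in _)%:R]mulr1 -(sum_U t u (fun=> 1)).
rewrite !mulr_sumr -sumrB; apply: eq_bigr => w _.
rewrite ipBl ipZl !b_orth -![inl _ == inl _]/((_, _) == (_, _)).
rewrite !xpair_eqE -!mulnb !natrM.
by rewrite /c; ring.
Qed.

Lemma lift_orth s t : s != t -> ip (lift s) (lift t) = 0.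
Proof.
move=> st; have ts : t != s by rewrite eq_sym.
have v_corr u w : ip (v u) (correction w) = 0.
  rewrite ip_sumr big1 // => i _.
  by rewrite ipBr (ipZr _ _ (theta_c _ _)) !v_b mulr0 subrr.
have theta_L w : theta (L w)%:R = (L w)%:R by rewrite rmorph_nat.
rewrite /lift /lift_tail !(ipDl, ipDr, ipZl) !(ipZr _ _ (theta_L _)).
rewrite !v_b !v_corr correction_h !(ip_eq0C (v_corr _ _), ip_eq0C (v_b _ _)).
rewrite b_orth (ip_eq0C (correction_h _ _)).
rewrite -[inr _ == inr _]/(s == t) (negbTE st) !mulr0 !addr0 !add0r.
(* Only [u = s] survives, contributing [- c s t] through [p t s] and again through [p s t]. If [U]
   relates [s] and [t] in one direction only, [v s] and [v t] are already orthogonal. *)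
rewrite ip_sumr (eq_bigr (fun u => (u == s)%:R * (- 2 * (t \in U s)%:R * c s t))).
  rewrite sum_U /c; case: (boolP (t \in U s)) => [_|tNs]; last first.
    by rewrite U_orth // !(mulr0, mul0r) addr0.
  case: (boolP (s \in U t)) => [_|sNt]; first by rewrite /=; field.
  have -> : ip (v s) (v t) = 0 by rewrite v_real U_orth.
  by rewrite !(mulr0, mul0r) addr0.
move=> u _; rewrite ipBr (ipZr _ _ (theta_c _ _)) !correction_p (negbTE st) /=.
rewrite [s == u]eq_sym; case: eqVneq => [->|_] /=; last by ring.
by rewrite /c (v_real t s); field.
Qed.

Lemma lift_norm2E t : lift_norm2 t = (L t)%:R ^+ 2 + lift_slack t.
Proof.
have theta_L : theta (L t)%:R = (L t)%:R by rewrite rmorph_nat.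
have hv : ip (h t) (v t + correction t) = 0.
  by apply: ip_eq0C; rewrite ipDl v_b correction_h addr0.
rewrite /lift_norm2 (_ : lift t = (L t)%:R *: h t + (v t + correction t)).
  rewrite ipDl !(ipDr _ (v t + _)) !ipZl !(ipZr _ _ theta_L) hv (ip_eq0C hv).
  by rewrite b_orth eqxx !mulr0 addr0 add0r mulr1 -expr2.
by rewrite /lift /lift_tail addrCA.
Qed.

Lemma lift_norm2_ge t : (L t)%:R ^+ 2 <= lift_norm2 t.
Proof. by rewrite lift_norm2E lerDl (ip_self_ge0 ip_norm). Qed.

Lemma lift_norm2_gt0 t : 0 < lift_norm2 t.
Proof. by rewrite (lt_le_trans _ (lift_norm2_ge t)) // exprn_gt0 // ltr0n. Qed.

Definition base (i : T * T + T) : H :=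
  b (match i with inl st => inl st | inr t => inr (inl t) end).
Definition tilt t : H := b (inr (inr t)).
Definition tilted t : H := lift t - (sigma t)%:R *: tilt t.
(** In the plane of [lift t] and [tilt t], this is the squared cosine of the angle between the lines
    orthogonal to [tilt t] and to [tilted t]; it tends to 1 as [sigma t] grows. *)
Definition damping t : K :=
  (sigma t)%:R ^+ 2 / (lift_norm2 t + (sigma t)%:R ^+ 2).

Let theta_nat (n : nat) : theta n%:R = n%:R.
Proof. exact: rmorph_nat. Qed.

Let lift_tilt s t : ip (lift s) (tilt t) = 0.
Proof. by rewrite !ipDl ipZl v_b correction_k b_orth mulr0 !addr0. Qed.

Lemma tilted_orth s t : s != t -> ip (tilted s) (tilted t) = 0.
Proof.
move=> st; rewrite ipBl ipZl !ipBr !(ipZr _ _ (theta_nat _)) lift_orth // lift_tilt.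
rewrite (ip_eq0C (lift_tilt _ _)) b_orth -[inr _ == inr _]/(s == t) (negbTE st) /=.
by ring.
Qed.

(** * The three projections and the operators [A (BC)^s] *)

Variables A B C : H -> H.
Hypothesis projA : perp_proj ip base A.
Hypothesis projB : perp_proj ip tilt B.
Hypothesis projC : perp_proj ip tilted C.

Lemma projA_lift t : A (lift t) = v t.
Proof.
apply: (perp_proj_unique ip_norm projA) => [i|z zA]; first exact: v_b.
rewrite /lift addrAC subrr add0r; apply: ip_eq0C.
rewrite ipDr (ipZr _ _ (theta_nat _)) [ip z (h t)](zA (inr t)) mulr0 add0r.
rewrite ip_sumr big1 // => u _.
rewrite ipBr (ipZr _ _ (theta_c _ _)).
by rewrite [ip z (p t u)](zA (inl (t, u))) [ip z (p u t)](zA (inl (u, t))) mulr0 subrr.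
Qed.

Lemma lift_norm2_ge_v t : ip (v t) (v t) <= lift_norm2 t.
Proof.
rewrite -[X in X <= _]ip_norm -[X in _ <= X]ip_norm ler_pXn2r ?nnegrE //.
by rewrite -projA_lift (perp_proj_le ip_norm projA).
Qed.

Lemma projBC_lift t : B (C (lift t)) = damping t *: lift t.
Proof.
have N0 := lift_norm2_gt0 t.
have D0 : lift_norm2 t + (sigma t)%:R ^+ 2 != 0.
  by rewrite gt_eqF // ltr_wpDr // exprn_ge0.
(* [C] removes the component of [lift t] along [tilted t], whose coefficient is [a]; [B] then
   discards the multiple of [tilt t] that is left. *)
pose a := lift_norm2 t / (lift_norm2 t + (sigma t)%:R ^+ 2).
have -> : C (lift t) = lift t - a *: tilted t.
  rewrite -[in LHS](subrK (a *: tilted t) (lift t)) (perp_projD ip_norm projC).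
  rewrite (perp_projZ ip_norm projC) (perp_proj0 ip_norm projC) scaler0 addr0.
  apply: (perp_proj_id ip_norm projC) => s.
  rewrite ipBl ipZl ipBl ipZl /tilted !ipBr !(ipZr _ _ (theta_nat _)) !lift_tilt.
  rewrite (ip_eq0C (lift_tilt _ _)) b_orth -[inr _ == inr _]/(t == s).
  have [<-|ts] := eqVneq t s; last by rewrite lift_orth //=; ring.
  by rewrite /= -/(lift_norm2 t) /a; field.
have -> : lift t - a *: tilted t = damping t *: lift t + (a * (sigma t)%:R) *: tilt t.
  rewrite /tilted scalerBr opprB addrCA addrC scalerA; congr (_ + _).
  rewrite -{1}[lift t]scale1r -scalerBl; congr (_ *: _).
  by rewrite /a /damping; field.
rewrite (perp_projD ip_norm projB) !(perp_projZ ip_norm projB).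
rewrite (perp_proj0 ip_norm projB) scaler0 addr0.
by rewrite (perp_proj_id ip_norm projB) // => s; apply: lift_tilt.
Qed.

Lemma iter_projBC_add s x y :
  iter s (B \o C) (x + y) = iter s (B \o C) x + iter s (B \o C) y.
Proof.
elim: s => //= s ->.
by rewrite (perp_projD ip_norm projC) (perp_projD ip_norm projB).
Qed.

Lemma iter_projBC_lift s a t :
  iter s (B \o C) (a *: lift t) = (a * damping t ^+ s) *: lift t.
Proof.
elim: s => [|s /= ->]; first by rewrite expr0 mulr1.
rewrite (perp_projZ ip_norm projC) (perp_projZ ip_norm projB) projBC_lift.
by rewrite scalerA; congr (_ *: _); rewrite exprS; ring.
Qed.

Lemma iter_projBC_id s x : annihilates ip lift x ->
  annihilates ip tilt x -> iter s (B \o C) x = x.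
Proof.
move=> xl xk; elim: s => //= s ->.
rewrite (perp_proj_id ip_norm projC) ?(perp_proj_id ip_norm projB) // => t.
by rewrite ipBr (ipZr _ _ (theta_nat _)) xl xk mulr0 subrr.
Qed.

(** Split [x] into its components along the lifts, which [BC] damps separately, and a remainder
    orthogonal to all lifts and tilts, which [BC] fixes. Finally [A] fixes [x] and sends each
    [lift u] to [v u]. *)
Lemma projA_iter_projBC s x (R : seq T) : uniq R ->
  (forall i, ip x (b i) = 0) -> (forall u, u \notin R -> ip x (v u) = 0) ->
  A (iter s (B \o C) x) =
  x - \sum_(u <- R) ((1 - damping u ^+ s) / lift_norm2 u * ip x (v u)) *: v u.
Proof.
move=> uR xb xv.
pose a u := ip x (v u) / lift_norm2 u.
have x_lift t : ip x (lift t) = ip x (v t).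
  rewrite !ipDr (ipZr _ _ (theta_nat _)) xb mulr0 add0r ip_sumr big1 ?addr0 // => u _.
  by rewrite ipBr (ipZr _ _ (theta_c _ _)) !xb mulr0 subrr.
have iter_sum : forall W, iter s (B \o C) (\sum_(u <- W) a u *: lift u) =
    \sum_(u <- W) (a u * damping u ^+ s) *: lift u.
  elim=> [|u W IHW]; last by rewrite !big_cons iter_projBC_add iter_projBC_lift IHW.
  by rewrite !big_nil iter_projBC_id // => t; rewrite ip0l.
have A_sum : forall (f : T -> K) W,
    A (\sum_(u <- W) f u *: lift u) = \sum_(u <- W) f u *: v u.
  move=> f; elim=> [|u W IHW]; last first.
    rewrite !big_cons (perp_projD ip_norm projA) (perp_projZ ip_norm projA).
    by rewrite projA_lift IHW.
  by rewrite !big_nil (perp_proj_id ip_norm projA) // => t; rewrite ip0l.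
have A0 : annihilates ip base x by move=> i; apply: xb.
rewrite -{1}(subrK (\sum_(u <- R) a u *: lift u) x) iter_projBC_add iter_sum.
rewrite iter_projBC_id; last 2 first.
- move=> t; rewrite ipBl ip_suml x_lift.
  have [tR|tR] := boolP (t \in R); last first.
    rewrite xv // big_seq big1 ?subrr // => u uR'.
    by rewrite ipZl lift_orth ?mulr0 //; apply: contraNneq tR => <-.
  rewrite (bigD1_seq t) //= big1 => [|u ut]; last by rewrite ipZl lift_orth ?mulr0.
  by rewrite addr0 ipZl /a divfK ?subrr // gt_eqF ?lift_norm2_gt0.
- move=> t; rewrite ipBl xb ip_suml big1 ?subrr // => u _.
  by rewrite ipZl lift_tilt mulr0.
rewrite -addrA -sumrN -big_split /=.
rewrite (eq_bigr (fun u => (a u * damping u ^+ s - a u) *: lift u)); last first.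
  by move=> u _; rewrite scalerBl addrC.
rewrite (perp_projD ip_norm projA) A_sum (perp_proj_id ip_norm projA) //.
congr (_ + _); rewrite -sumrN; apply: eq_bigr => u _; rewrite -[RHS]scaleNr.
by congr (_ *: _); rewrite /a; ring.
Qed.

Definition compression (s : nat) (x : H) : H := A (iter s (B \o C) x).

Lemma compressionB s x y : compression s (x - y) = compression s x - compression s y.
Proof.
rewrite /compression -(perp_projB ip_norm projA); congr (A _).
elim: s => //= s ->.
by rewrite (perp_projB ip_norm projC) (perp_projB ip_norm projB).
Qed.

Lemma compression_le s x : `|compression s x| <= `|x|.
Proof.
rewrite (le_trans (perp_proj_le ip_norm projA _)) //.
elim: s => //= s; apply: le_trans.
by rewrite (le_trans (perp_proj_le ip_norm projB _)) // (perp_proj_le ip_norm projC).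
Qed.

(** * Separating active from inactive steps *)

Variables (prec : rel T) (q V M : T -> nat).
(* Once [t] is active, one application multiplies [v t] by at most
   [1 - 1 / (2 * (L t ^ 2 + M t))], so by Bernoulli's inequality this many of them
   reduce it by the factor [1 / q t].  The other steps near [t] contribute at most
   [1 / tolerance t] each per application, hence [1 / q t] altogether. *)
Definition power t : nat := 2 * q t * (L t ^ 2 + M t).
Definition tolerance t : nat := q t * size (U t) * power t.

Hypothesis q_gt0 : forall t, (0 < q t)%N.
Hypothesis U_refl : forall t, t \in U t.
Hypothesis sigma_gt1 : forall t, (1 < sigma t)%N.
Hypothesis V_bound : forall t, ip (v t) (v t) <= (V t)%:R.
Hypothesis M_bound : forall t, lift_slack t <= (M t)%:R.
Hypothesis L_large : forall t u, u \in U t -> prec u t ->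
  (tolerance t * V u <= L u)%N.
Hypothesis sigma_large : forall t u, u \in U t -> prec t u ->
  (sigma t ^ 2 * (tolerance t * V u) <= sigma u)%N.

Let power_gt0 t : (0 < power t)%N.
Proof. by rewrite !muln_gt0 q_gt0 addn_gt0 expn_gt0 L_gt0. Qed.

Let tolerance_gt0 t : (0 < tolerance t)%N.
Proof.
rewrite /tolerance muln_gt0 power_gt0 muln_gt0 q_gt0 andbT lt0n size_eq0.
by apply: contraTneq (U_refl t) => ->.
Qed.

Let damping_bound t : 0 <= damping t <= 1.
Proof.
have N0 := lift_norm2_gt0 t; rewrite /damping.
rewrite divr_ge0 ?exprn_ge0 ?addr_ge0 ?(ltW N0) //=.
by rewrite ler_pdivrMr ?mul1r ?lerDr ?(ltW N0) // ltr_wpDr ?exprn_ge0.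
Qed.

Let one_sub_damping t :
  1 - damping t = lift_norm2 t / (lift_norm2 t + (sigma t)%:R ^+ 2).
Proof.
have N0 := lift_norm2_gt0 t; rewrite /damping; field.
by rewrite gt_eqF // ltr_wpDr ?exprn_ge0.
Qed.

(** If [u] precedes [t], its lift is so long that its weight is negligible even when fully active.
    If [t] precedes [u], then [sigma u] is so large that [u] is still inactive: [bernoulli_growth]
    gives a factor [lift_norm2 u] that cancels the denominator. *)
Let stray_coefficient t u : u \in U t -> prec u t || prec t u ->
  (1 - damping u ^+ (sigma t ^ 2)) / lift_norm2 u * ip (v u) (v u) <=
  (tolerance t)%:R^-1.
Proof.
have N0 := lift_norm2_gt0 u; have /andP[d0 d1] := damping_bound u.
have T0 : 0 < (tolerance t)%:R :> K by rewrite ltr0n.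
have vv0 : 0 <= ip (v u) (v u) := ip_self_ge0 ip_norm _.
have vT : ip (v u) (v u) * (tolerance t)%:R <= (tolerance t * V u)%:R.
  by rewrite mulrC natrM ler_wpM2l.
move=> uU utu; rewrite mulrAC ler_pdivrMr // [leRHS]mulrC ler_pdivlMr // -mulrA.
have e0 : 0 <= 1 - damping u ^+ (sigma t ^ 2) by rewrite subr_ge0 exprn_ile1.
case/orP: utu => [ut|tu].
  rewrite (le_trans (ler_wpM2l e0 vT)) // (le_trans (ler_piMl (ler0n _ _) _)) //.
    by rewrite gerBl exprn_ge0.
  apply: le_trans (lift_norm2_ge u); rewrite -natrX ler_nat.
  rewrite (leq_trans (L_large uU ut)) // -[X in (X <= _)%N]expn1 leq_exp2l // L_gt1.
have D0 : 0 < lift_norm2 u + (sigma u)%:R ^+ 2 by rewrite ltr_wpDr ?exprn_ge0.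
rewrite (le_trans (ler_wpM2r _ (bernoulli_growth _ (damping_bound u)))) ?mulr_ge0 //.
rewrite one_sub_damping (_ : _ * _ * _ = (lift_norm2 u * ((sigma t ^ 2)%:R *
  (ip (v u) (v u) * (tolerance t)%:R))) / (lift_norm2 u + (sigma u)%:R ^+ 2));
  last by ring.
rewrite ler_pdivrMr // ler_wpM2l ?(ltW N0) //.
rewrite (le_trans (ler_wpM2l (ler0n _ _) vT)) // -natrM.
rewrite (@le_trans _ _ ((sigma u)%:R ^+ 2)) // ?lerDr ?(ltW N0) // -natrX ler_nat.
rewrite (leq_trans (sigma_large uU tu)) // -[X in (X <= _)%N]expn1 leq_exp2l // sigma_gt1.
Qed.

Variables (t : T) (P : H -> Prop).
Hypothesis P_b : forall x, P x -> forall i, ip x (b i) = 0.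
Hypothesis P_stable : forall x a, P x -> P (x + a *: v t).
Hypothesis P_v : forall x u, P x -> u != t ->
  ip x (v u) = 0 \/ u \in U t /\ (prec u t || prec t u).
Hypothesis v_ge1 : 1 <= ip (v t) (v t).

Let delta : K := (q t * power t)%:R^-1.
Let gamma : K := (1 - damping t ^+ (sigma t ^ 2)) / lift_norm2 t.

(** The term [u = t] is the intended one. Each of the fewer than [size (U t)] others costs at most
    [|x| / tolerance t]. *)
Let compression_approx x : P x ->
  `|compression (sigma t ^ 2) x - (x - (gamma * ip x (v t)) *: v t)| <=
  delta * `|x|.
Proof.
move=> Px; rewrite /compression (projA_iter_projBC _ (U_uniq t) (P_b Px)); last first.
  move=> u uU; have ut : u != t by apply: contraNneq uU => ->.
  by have [//|[]] := P_v Px ut; rewrite (negbTE uU).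
rewrite (bigD1_seq t) //= opprD addrA [X in X - _]addrC addrK normrN.
rewrite (le_trans (ler_norm_sum _ _ _)) //.
have T0 : 0 <= (tolerance t)%:R^-1 * `|x| by rewrite mulr_ge0 // invr_ge0.
apply: (@le_trans _ _ (\sum_(u <- U t | u != t) (tolerance t)%:R^-1 * `|x|)).
  rewrite [leLHS]big_seq_cond [leRHS]big_seq_cond.
  apply: ler_sum => u /andP[uU ut].
  have [->|[_ utu]] := P_v Px ut; first by rewrite mulr0 scale0r normr0.
  have /andP[d0 d1] := damping_bound u.
  rewrite normrZ normrM ger0_norm; last first.
    by rewrite divr_ge0 ?(ltW (lift_norm2_gt0 u)) // subr_ge0 exprn_ile1.
  apply: le_trans (ler_wpM2r (normr_ge0 x) (stray_coefficient uU utu)).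
  rewrite -!mulrA ler_wpM2l ?subr_ge0 ?exprn_ile1 //.
  rewrite ler_wpM2l ?invr_ge0 ?(ltW (lift_norm2_gt0 u)) //.
  rewrite -ip_norm expr2 mulrAC ler_wpM2r // mulrC.
  by rewrite (cauchy_schwarz ip_norm).
rewrite big_const_seq iter_addr addr0 -[leLHS]mulr_natr.
rewrite (@le_trans _ _ ((tolerance t)%:R^-1 * `|x| * (size (U t))%:R)) //.
  by rewrite ler_wpM2l // ler_nat count_size.
rewrite /delta /tolerance mulnAC natrM mulrAC invfM divfK //.
by rewrite pnatr_eq0 size_eq0; apply: contraTneq (U_refl t) => ->.
Qed.

Let half_damped : 2^-1 <= 1 - damping t ^+ (sigma t ^ 2).
Proof.
have /andP[d0 d1] := damping_bound t; have N0 := lift_norm2_gt0 t.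
have N4 : 4 <= lift_norm2 t.
  apply: le_trans (lift_norm2_ge t).
  by rewrite -natrX ler_nat -[4%N]/(2 ^ 2)%N leq_exp2r ?L_gt1.
have s4 : 4 <= (sigma t)%:R ^+ 2 :> K.
  by rewrite -natrX ler_nat -[4%N]/(2 ^ 2)%N leq_exp2r ?sigma_gt1.
have D0 : 0 < lift_norm2 t + (sigma t)%:R ^+ 2.
  by rewrite addr_gt0 // (lt_le_trans _ s4).
(* With [N = lift_norm2 t] and [s = sigma t ^ 2], both at least 4, the claim [N s / (N + s) >= 1]
   amounts to [(s - 1) (N - 1) >= 1]. Then [bernoulli_decay] gives [damping t ^ s <= 1 / 2]. *)
have sd : 1 <= (sigma t ^ 2)%:R * (1 - damping t).
  rewrite one_sub_damping mulrA ler_pdivlMr // mul1r natrX -subr_ge0.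
  rewrite (_ : _ - _ = ((sigma t)%:R ^+ 2 - 1) * (lift_norm2 t - 1) - 1); last by ring.
  have two4 : 1 + 1 <= 4 :> K by rewrite -(natrD _ 1 1) ler_nat.
  by rewrite subr_ge0 -[leLHS]mulr1 ler_pM // lerBrDr (le_trans two4).
have := @bernoulli_decay _ (1 - damping t) (sigma t ^ 2).
rewrite subr_ge0 d1 gerBl d0 subKr => /(_ isT) ds.
have : damping t ^+ (sigma t ^ 2) * 2 <= 1.
  apply: le_trans ds; rewrite ler_wpM2l ?exprn_ge0 //.
  by rewrite (_ : 2 = 1 + 1 :> K) ?lerD2l.
rewrite -ler_pdivlMr // div1r => ds2.
by rewrite lerBrDr [leRHS]splitr div1r lerD2l.
Qed.

(** One [1 / q t] is the accumulated error [power t * delta]. The other bounds the remaining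
    component: by [half_damped] and [v_ge1] one application removes at least the fraction
    [1 / (2 * lift_norm2 t)], and [power t] is at least [2 * q t * lift_norm2 t]. *)
Lemma compression_power x : P x ->
  `|iter (power t) (compression (sigma t ^ 2)) x - reject ip x (v t)| <=
  2 / (q t)%:R * `|x|.
Proof.
move=> Px; have N0 := lift_norm2_gt0 t.
have q0 : 0 < (q t)%:R :> K by rewrite ltr0n.
have r0 : 0 < (power t)%:R :> K by rewrite ltr0n.
have /andP[d0 d1] := damping_bound t.
have c0 : 0 <= gamma * ip (v t) (v t).
  rewrite mulr_ge0 ?(ip_self_ge0 ip_norm) // divr_ge0 ?(ltW N0) //.
  by rewrite subr_ge0 exprn_ile1.
have c1 : gamma * ip (v t) (v t) <= 1.
  rewrite /gamma mulrAC ler_pdivrMr // mul1r.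
  apply: le_trans (lift_norm2_ge_v t); rewrite ler_piMl ?(ip_self_ge0 ip_norm) //.
  by rewrite gerBl exprn_ge0.
have vt0 : v t != 0 by apply: contraTneq v_ge1 => ->; rewrite ip0l ler10.
rewrite (_ : 2 / (q t)%:R = (power t)%:R * delta + (q t)%:R^-1); last first.
  rewrite /delta natrM; field; rewrite !gt_eqF //.
have := approximate_power ip_norm (@compressionB (sigma t ^ 2))
  (@compression_le (sigma t ^ 2)) vt0 (gamma := gamma) (delta := delta) (D := P).
rewrite c0 c1 invr_ge0 ler0n => /(_ isT isT P_stable compression_approx (power t) x Px).
move/le_trans; apply; rewrite ler_wpM2r // lerD2l.
have := @bernoulli_decay _ (gamma * ip (v t) (v t)) (power t).
rewrite c0 c1 => /(_ isT) cr.
rewrite -[leRHS]div1r ler_pdivlMr //; apply: le_trans cr.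
rewrite ler_wpM2l ?exprn_ge0 ?subr_ge0 //.
suff : (q t)%:R <= (power t)%:R * (gamma * ip (v t) (v t)).
  by move/le_trans; apply; rewrite lerDr.
apply: (@le_trans _ _ ((power t)%:R * (2^-1 / lift_norm2 t))).
  rewrite (_ : _ * _ = (q t)%:R * ((L t ^ 2 + M t)%:R / lift_norm2 t)); last first.
    by rewrite /power !natrM; field; rewrite gt_eqF.
  rewrite ler_peMr // ler_pdivlMr // mul1r lift_norm2E natrD natrX lerD2l.
  exact: M_bound.
rewrite ler_wpM2l // (@le_trans _ _ gamma) // /gamma.
  by rewrite ler_wpM2r // invr_ge0 ltW.
by rewrite ler_peMr // divr_ge0 ?(ltW N0) // subr_ge0 exprn_ile1.
Qed.

End Dilation.

(** * Words and recursive choices *)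

Lemma rank_recursion (T : eqType) (pred : T -> seq T) (rank : T -> nat)
    (F : T -> T -> nat -> nat) :
  (forall u t, t \in pred u -> (rank t < rank u)%N) ->
  exists f : T -> nat, (forall u, (1 < f u)%N) /\
    forall u t, t \in pred u -> (F u t (f t) <= f u)%N.
Proof.
move=> rank_pred.
(* Recursion on fuel [n]; the value is independent of the fuel once it exceeds the rank. A sum
   dominates each of its terms, and the summand 2 gives [1 < f u]. *)
pose g := fix g n u : nat :=
  if n is m.+1 then (2 + \sum_(t <- pred u) F u t (g m t))%N else 0%N.
have g_stable m n u : (rank u < m)%N -> (rank u < n)%N -> g m u = g n u.
  elim: m n u => // m IHm [//|n] u um un /=; congr (_ + _)%N.
  rewrite !big_seq; apply: eq_bigr => t tu; congr (F _ _ _).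
  by apply: IHm; apply: leq_trans (rank_pred _ _ tu) _.
exists (fun u => g (rank u).+1 u); split=> // u t tu.
rewrite [X in (_ <= X)%N]/= (big_rem t tu) [X in (_ <= X)%N]/= addnCA.
rewrite (g_stable (rank t).+1 (rank u) t) ?rank_pred //.
exact: leq_addr.
Qed.

Section Words.
Context {H : Type}.
Implicit Types (letter : (H -> H) -> Prop) (F G : H -> H) (w : seq (H -> H)).

Definition run w x := foldl (fun y F => F y) x w.

(** Nonemptiness ensures that concatenating infinitely many words gives an infinite sequence of
    letters. *)
Definition is_word letter F := exists w, [/\ (0 < size w)%N,
  forall i, (i < size w)%N -> letter (nth id w i) & F =1 run w].

Lemma word_letter letter F : letter F -> is_word letter F.
Proof. by move=> lF; exists [:: F]; split=> // -[]. Qed.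

Lemma word_comp letter F G : is_word letter F -> is_word letter G ->
  is_word letter (F \o G).
Proof.
move=> [w [w0 lw Fw]] [w' [w'0 lw' Gw']]; exists (w' ++ w); split.
- by rewrite size_cat addn_gt0 w0 orbT.
- move=> i; rewrite size_cat nth_cat;
  case: (ltnP i (size w')) => [lt_i _|le_i lt_i]; first exact: lw'.
  by apply: lw; rewrite ltn_subLR.
- by move=> x /=; rewrite Gw' Fw /run foldl_cat.
Qed.

Lemma word_ext letter F G : F =1 G -> is_word letter F -> is_word letter G.
Proof. by move=> FG [w [w0 lw Fw]]; exists w; split=> // x; rewrite -FG. Qed.

Lemma word_iter letter F n : is_word letter F -> (0 < n)%N ->
  is_word letter (iter n F).
Proof.
move=> wF; case: n => // n _; elim: n => [|n IHn]; first exact: word_ext wF.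
exact: word_ext (word_comp wF IHn).
Qed.

Lemma word_iteri letter (F : nat -> H -> H) n :
  (forall i, (i < n)%N -> is_word letter (F i)) -> (0 < n)%N ->
  is_word letter (iteri n F).
Proof.
case: n => // n wF _; elim: n wF => [|n IHn] wF; first exact: word_ext (wF 0%N _).
apply: word_ext (word_comp (wF n.+1 _) (IHn _)) => // i lt_in.
exact/wF/ltnW.
Qed.

Lemma words_concatenation letter (F : nat -> H -> H) :
  (forall n, is_word letter (F n)) ->
  exists P : nat -> H -> H, (forall n, (1 <= n)%N -> letter (P n)) /\
  exists N : nat -> nat, (forall n, (n <= N n)%N) /\
    forall n x, product P (N n) x = iteri n F x.
Proof.
move=> /choice[w wP].
pose W n := iteri n (fun i u => u ++ w i) [::].
have WS n : W n.+1 = W n ++ w n by [].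
have size_W n : (n <= size (W n))%N.
  elim: n => // n IHn; rewrite WS size_cat -addn1 leq_add //.
  by have [] := wP n.
have nth_W m n i : (m <= n)%N -> (i < size (W m))%N ->
    nth id (W n) i = nth id (W m) i.
  move=> /subnK <-; elim: (n - m)%N => // d IHd lt_i.
  rewrite addSn WS nth_cat IHd //; case: ltnP => // le_i; exfalso.
  suff : (size (W m) <= size (W (d + m)))%N.
    by move=> /leq_trans/(_ le_i); rewrite leqNgt lt_i.
  elim: (d) => // c IHc; rewrite addSn WS size_cat.
  exact: leq_trans IHc (leq_addr _ _).
have letter_W n i : (i < size (W n))%N -> letter (nth id (W n) i).
  elim: n => // n IHn; rewrite WS size_cat nth_cat.
  case: (ltnP i (size (W n))) => [lt_i _|le_i lt_i]; first exact: IHn.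
  by have [_ + _] := wP n; apply; rewrite ltn_subLR.
(* [product] applies [P 1] first, so letter [n] sits at position [n - 1]; it already occurs in the
   prefix [W n], whose size is at least [n]. *)
exists (fun n => nth id (W n) n.-1); split.
  by move=> [//|n] _; apply: letter_W; apply: size_W.
exists (fun n => size (W n)); split=> // n x.
have -> : product (fun n => nth id (W n) n.-1) (size (W n)) x = run (W n) x.
  rewrite -[in RHS](take_size (W n)).
  suff H_take m : (m <= size (W n))%N ->
      product (fun n => nth id (W n) n.-1) m x = run (take m (W n)) x by exact: H_take.
  elim: m => [|m IHm] lt_m; first by rewrite take0.
  rewrite (take_nth id) // /run -cats1 foldl_cat /= IHm 1?ltnW //.
  congr (_ _); have [le_mn|/ltnW le_nm] := leqP m.+1 n.
    by rewrite (nth_W _ _ _ le_mn) // size_W.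
  by rewrite (nth_W _ _ _ le_nm).
elim: n => // n IHn; rewrite WS [LHS]foldl_cat -/(run (W n) x) IHn.
by have [_ _ wE] := wP n; rewrite iteriS wE.
Qed.

End Words.

(** * Rotation through many small steps *)

Section RotationPath.
Context {K : numFieldType} {theta : {rmorphism K -> K}}.
Context {H : completeNormedModType K} {ip : {dot H for theta}}.
Hypothesis ip_norm : induces_norm ip.
Variables (e f : H) (k : nat).
Hypothesis ee : ip e e = 1.
Hypothesis ff : ip f f = 1.
Hypothesis ef : ip e f = 0.
Hypothesis k_gt0 : (0 < k)%N.

(** Orthogonal, in the plane of [e] and [f], to point [j + 1] of the segment from [k e] to [k f] cut
    into [k] equal parts. Following the segment instead of the arc keeps all coordinates
    integral. *)
Definition path_normal (j : nat) : H :=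
  - (j.+1)%:R *: e + (k - j.+1)%:R *: f.

Lemma theta_natN (n : nat) : theta (- n%:R) = - n%:R.
Proof. by rewrite rmorphN /= rmorph_nat. Qed.

Lemma ip_path_normal x j :
  ip x (path_normal j) = (k - j.+1)%:R * ip x f - j.+1%:R * ip x e.
Proof.
rewrite ipDr (ipZr _ _ (theta_natN _)) (ipZr _ _ (rmorph_nat _ _)).
by rewrite mulNr addrC.
Qed.

Lemma path_normal_norm2 j : ip (path_normal j) (path_normal j) =
  (k - j.+1)%:R ^+ 2 + j.+1%:R ^+ 2.
Proof.
by rewrite ip_path_normal !ipDl !ipZl ee ff ef (ip_eq0C ef); ring.
Qed.

Let path_point (j : nat) : H := (k - j)%:R *: e + j%:R *: f.

(** Each rejection projects onto the line through the next point of the segment. All points have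
    squared norm at least [k^2 / 2], so a step loses at most [4 / k^2] of the squared norm. *)
Lemma rejects_path j : (j <= k)%N -> exists lambda : K,
  [/\ 0 <= lambda,
      iteri j (fun i x => reject ip x (path_normal i)) e = lambda *: path_point j &
      1 - 4 * j%:R / k%:R ^+ 2 <= lambda ^+ 2 * ((k - j)%:R ^+ 2 + j%:R ^+ 2) <= 1].
Proof.
have k0 : 0 < k%:R :> K by rewrite ltr0n.
elim: j => [|j IHj] ltjk.
  exists k%:R^-1; rewrite invr_ge0 ler0n /path_point subn0 scale0r addr0 scalerA.
  rewrite mulVf ?gt_eqF // scale1r !mulr0 mul0r subr0 expr0n addr0 -exprMn.
  by rewrite mulVf ?gt_eqF // expr1n lexx.
have [lambda [lambda0 xE /andP[lo hi]]] := IHj (ltnW ltjk).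
rewrite iteriS xE.
pose a : K := (k - j.+1)%:R; pose b : K := j.+1%:R.
have aE : (k - j)%:R = a + 1 by rewrite /a natr1 subnSK.
have bE : j%:R = b - 1 by rewrite /b -natr1 addrK.
have kE : k%:R = a + b by rewrite /a /b -natrD subnK.
have a0 : 0 <= a by rewrite ler0n.
have b1 : 1 <= b by rewrite ler1n.
pose m := a ^+ 2 + b ^+ 2.
have m0 : 0 < m by rewrite ltr_wpDl ?exprn_ge0 // exprn_gt0 // (lt_le_trans ltr01).
have k2m : k%:R ^+ 2 <= 2 * m.
  rewrite -subr_ge0 (_ : _ - _ = (a - b) ^+ 2); last by rewrite kE /m; ring.
  by rewrite real_exprn_even_ge0 // realB ?realn.
have k2w : k%:R ^+ 2 <= 2 * ((k - j)%:R ^+ 2 + j%:R ^+ 2) :> K.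
  rewrite -subr_ge0 (_ : _ - _ = (a - b + 2) ^+ 2); last by rewrite kE aE bE; ring.
  by rewrite real_exprn_even_ge0 // realD ?realB ?realn.
have l2k2 : lambda ^+ 2 * k%:R ^+ 2 <= 2.
  rewrite (le_trans (ler_wpM2l _ k2w)) ?exprn_ge0 // mulrCA.
  by rewrite -[leRHS]mulr1 ler_wpM2l.
have loss : lambda ^+ 2 * k%:R ^+ 2 / m <= 4 / k%:R ^+ 2.
  rewrite ler_pdivrMr // [leRHS]mulrAC ler_pdivlMr ?exprn_gt0 //.
  rewrite (le_trans (ler_wpM2r _ l2k2)) ?exprn_ge0 //.
  by rewrite (le_trans (ler_wpM2l _ k2m)) // mulrA -natrM.
have mE : (k - j.+1)%:R ^+ 2 + j.+1%:R ^+ 2 = m by [].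
(* Pythagoras: consecutive points have inner product [m + a - b], and point [j] has inner product
   [- k] with the normal of squared norm [m]. *)
have stepE : (lambda * ((m + a - b) / m)) ^+ 2 * m =
    lambda ^+ 2 * ((k - j)%:R ^+ 2 + j%:R ^+ 2) - lambda ^+ 2 * k%:R ^+ 2 / m.
  by rewrite aE bE kE /m; field; rewrite gt_eqF.
exists (lambda * ((m + a - b) / m)); rewrite mE stepE; split.
- rewrite mulr_ge0 // divr_ge0 ?(ltW m0) //.
  rewrite (_ : _ - _ = a ^+ 2 + b * (b - 1) + a); last by rewrite /m; ring.
  by rewrite !addr_ge0 ?exprn_ge0 ?mulr_ge0 ?subr_ge0 // (le_trans ler01).
- rewrite /reject path_normal_norm2 mE ip_path_normal !ipZl !ipDl !ipZl.
  rewrite ee ff ef (ip_eq0C ef).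
  rewrite /path_point /path_normal aE bE -/a -/b !scalerDr !scalerA opprD addrACA.
  by rewrite -!scalerBl; congr (_ *: _ + _ *: _); rewrite /m; field; rewrite gt_eqF.
- apply/andP; split; last first.
    by rewrite (le_trans _ hi) // gerBl divr_ge0 ?(ltW m0) // mulr_ge0 ?exprn_ge0.
  rewrite (le_trans _ (lerB lo loss)) // -subr_ge0 (_ : _ - _ = 0) //.
  by rewrite -natr1; field; rewrite gt_eqF.
Qed.

Lemma rejects_path_le j : (j <= k)%N ->
  `|iteri j (fun i x => reject ip x (path_normal i)) e| <= 1.
Proof.
elim: j => [_|j IHj lt_jk].
  by rewrite -(@ler_pXn2r _ 2) ?nnegrE // ip_norm ee expr1n.
by rewrite iteriS (le_trans (norm_reject ip_norm _ _)) // IHj // ltnW.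
Qed.

(** The path ends at [c f] with [0 <= c <= 1], so [1 - c <= 1 - c^2 <= 4 / k]. *)
Lemma rejects_path_end :
  `|iteri k (fun i x => reject ip x (path_normal i)) e - f| <= 4 / k%:R.
Proof.
have k0 : 0 < k%:R :> K by rewrite ltr0n.
have [lambda [lambda0 -> ]] := rejects_path (leqnn k).
rewrite /path_point subnn scale0r add0r expr0n add0r scalerA -exprMn.
set c := lambda * k%:R; have c0 : 0 <= c by rewrite mulr_ge0.
have -> : 4 * k%:R / k%:R ^+ 2 = 4 / k%:R :> K by field; rewrite gt_eqF.
move=> /andP[lo hi]; have c1 : c <= 1.
  by rewrite -(@ler_pXn2r _ 2) ?nnegrE // expr1n.
have nf : `|f| = 1.
  by apply/eqP; rewrite -(@eqrXn2 _ 2) // ip_norm ff expr1n.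
rewrite -[X in _ - X]scale1r -scalerBl normrZ nf mulr1 distrC ger0_norm ?subr_ge0 //.
rewrite lerBlDr -lerBlDl (le_trans lo) //.
by rewrite expr2 ler_piMl.
Qed.

End RotationPath.

(** * The construction *)

Section Schedule.

(* Moving along block [n] costs [6 / block_length n]; these errors sum to [3 / 16]. *)
Definition block_length (n : nat) : nat := 2 ^ (n + 6).
Local Notation len := block_length.

Lemma block_length_gt0 n : (0 < len n)%N. Proof. by rewrite expn_gt0. Qed.

(** Besides blocks [n - 1], [n] and [n + 1] all lower ones are listed; the resulting asymmetry is
    harmless in [lift_orth]. *)
Definition near (n : nat) : seq (nat * nat) :=
  [seq (i, j) | i <- iota 0 n.+2, j <- iota 0 (len i)].

Lemma mem_near n u : (u \in near n) = (u.1 < n.+2)%N && (u.2 < len u.1)%N.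
Proof.
case: u => i j /=; apply/allpairsPdep/andP => [[i' [j' []]]|[ltin ltj]].
  by rewrite !mem_iota /= !add0n => lti ltj [-> ->].
by exists i, j; rewrite !mem_iota.
Qed.

(** Adding [t] matters for pairs beyond the end of their block, which [near] omits. *)
Definition neighbours (t : nat * nat) : seq (nat * nat) := undup (t :: near t.1).

(* Step [u] becomes active before step [t] as the exponent grows, and with a smaller
   weight. *)
Definition earlier (u t : nat * nat) : bool :=
  [&& (u.2 < len u.1)%N, (t.2 < len t.1)%N &
    ((u.1 == t.1) && (u.2 < t.2)%N) ||
    [&& ~~ odd u.1, odd t.1 & (u.1 == t.1.+1) || (t.1 == u.1.+1)]].

Lemma earlier_near u t : earlier u t -> (u \in near t.1) && (t \in near u.1).
Proof.
rewrite !mem_near => /and3P[-> -> /orP[/andP[/eqP -> _]|/and3P[_ _ /orP[]/eqP ->]]];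
  by rewrite !andbT !ltnS ?leqnn ?leqW.
Qed.

Let load n := (\sum_(i < n.+2) len i)%N.

Let len_load m n : (m < n.+2)%N -> (len m <= load n)%N.
Proof. by move=> mn; rewrite /load (bigD1 (Ordinal mn)) //= leq_addr. Qed.

(** This will choose the lengths [L], where each step has to dominate the later ones. *)
Lemma earlier_recursion (F : nat * nat -> nat * nat -> nat -> nat) :
  exists f : nat * nat -> nat, (forall t, (1 < f t)%N) /\
    forall u t, earlier u t -> (F u t (f t) <= f u)%N.
Proof.
(* The rank counts the steps left in the block; [load] lifts every step of an even block above the
   adjacent odd blocks. *)
pose rank u := ((if odd u.1 then 0 else load u.1) + (len u.1 - u.2))%N.
have [|f [f1 fF]] := @rank_recursion _
    (fun u => [seq t <- near u.1 | earlier u t]) rank F.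
  move=> u t; rewrite mem_filter => /andP[ut _]; rewrite /rank.
  case/and3P: ut => ltu ltt /orP[/andP[/eqP e lt_ut]|].
    by rewrite -e ltn_add2l ltn_sub2l.
  case/and3P => /negbTE -> -> adj; rewrite add0n.
  apply: (@leq_ltn_trans (load u.1)); last by rewrite -addn1 leq_add2l subn_gt0.
  apply: leq_trans (leq_subr _ _) (len_load _).
  by case/orP: adj => /eqP ->; rewrite ?ltnS ?leqW.
exists f; split=> // u t ut; apply: fF; rewrite mem_filter ut.
by have /andP[] := earlier_near ut.
Qed.

(** This will choose [sigma], where each step has to dominate the earlier ones; the rank now counts
    steps already done and puts odd blocks on top. *)
Lemma later_recursion (F : nat * nat -> nat * nat -> nat -> nat) :
  exists f : nat * nat -> nat, (forall t, (1 < f t)%N) /\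
    forall u t, earlier t u -> (F u t (f t) <= f u)%N.
Proof.
pose rank u := ((if odd u.1 then load u.1 else 0) + u.2)%N.
have [|f [f1 fF]] := @rank_recursion _
    (fun u => [seq t <- near u.1 | earlier t u]) rank F.
  move=> u t; rewrite mem_filter => /andP[ut _]; rewrite /rank.
  case/and3P: ut => ltt ltu /orP[/andP[/eqP e lt_ut]|].
    by rewrite e ltn_add2l.
  case/and3P => /negbTE -> -> adj; rewrite add0n.
  apply: (@leq_trans (load u.1)); last exact: leq_addr.
  apply: leq_trans ltt (len_load _).
  by case/orP: adj => /eqP ->; rewrite ?ltnS ?leqW.
exists f; split=> // u t ut; apply: fF; rewrite mem_filter ut.
by have /andP[] := earlier_near ut.
Qed.

End Schedule.

(** * Assembling the projections and the divergent orbit *)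

Section Construction.
Context {K : numFieldType} {theta : {rmorphism K -> K}}.
Context {H : completeNormedModType K} {ip : {dot H for theta}}.
Hypothesis ip_norm : induces_norm ip.
Hypothesis mcK : monotone_cauchy K.

Local Notation T := (nat * nat)%type.
Local Notation len := block_length.

Variable E : nat -> H.
Hypothesis E_orth : forall m n, ip (E m) (E n) = (m == n)%:R.

(** One orthonormal sequence is divided into the vertices [e] of the path and the auxiliary vectors
    [b]. *)
Let e (n : nat) : H := E (pickle (inl n : nat + ((T * T) + (T + T)))).
Let b (i : (T * T) + (T + T)) : H := E (pickle (inr i : nat + ((T * T) + (T + T)))).

Let e_orth m n : ip (e m) (e n) = (m == n)%:R.
Proof. by rewrite E_orth (inj_eq (pcan_inj pickleK)). Qed.

Let b_orth i j : ip (b i) (b j) = (i == j)%:R.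
Proof. by rewrite E_orth (inj_eq (pcan_inj pickleK)). Qed.

Let e_b n i : ip (e n) (b i) = 0.
Proof. by rewrite E_orth (inj_eq (pcan_inj pickleK)). Qed.

Let normal (t : T) : H := path_normal (e t.1) (e t.1.+1) (len t.1) t.2.
Let v (t : T) : H := if (t.2 < len t.1)%N then normal t else 0.

Let ip_normal x t : ip x (normal t) =
  (len t.1 - t.2.+1)%:R * ip x (e t.1.+1) - t.2.+1%:R * ip x (e t.1).
Proof. exact: ip_path_normal. Qed.

Let normal_ip t x : ip (normal t) x =
  (len t.1 - t.2.+1)%:R * ip (e t.1.+1) x - t.2.+1%:R * ip (e t.1) x.
Proof. by rewrite /normal /path_normal ipDl !ipZl mulNr addrC. Qed.

Let v_b t i : ip (v t) (b i) = 0.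
Proof.
rewrite /v; case: ifP => _; last exact: ip0l.
by rewrite normal_ip !e_b !mulr0 subrr.
Qed.

Let v_real s t : ip (v s) (v t) = ip (v t) (v s).
Proof.
rewrite /v; case: ifP => _; case: ifP => _; rewrite ?ip0l ?ip0r //.
rewrite !normal_ip !ip_normal !e_orth.
by rewrite (eq_sym t.1) (eq_sym t.1.+1) (eq_sym t.1) (eq_sym t.1.+1); ring.
Qed.

Let v_far x t : ip x (e t.1) = 0 -> ip x (e t.1.+1) = 0 -> ip x (v t) = 0.
Proof.
move=> x0 x1; rewrite /v; case: ifP => _; last exact: ip0r.
by rewrite ip_normal x0 x1 !mulr0 subrr.
Qed.

Let U_orth s t : s != t -> t \notin neighbours s -> ip (v s) (v t) = 0.
Proof.
rewrite mem_undup inE negb_or mem_near => _ /andP[_].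
rewrite negb_and -!leqNgt => /orP[st|tN]; last by rewrite [v t]/v ltnNge tN ip0r.
rewrite [v s]/v; case: ifP => _; last by rewrite ip0l.
have far i j : (i <= s.1.+1)%N -> (t.1 <= j)%N -> ip (e i) (e j) = 0.
  by move=> is1 tj; rewrite e_orth ltn_eqF // (leq_ltn_trans is1) // (leq_trans st).
by apply: v_far; rewrite normal_ip !far ?mulr0 ?subrr.
Qed.

Let weight (t : T) : nat := (len t.1 - t.2.+1) ^ 2 + t.2.+1 ^ 2.

Let normal_norm2 t : ip (normal t) (normal t) = (weight t)%:R.
Proof.
rewrite /normal path_normal_norm2 ?e_orth ?eqxx //; last by rewrite ltn_eqF.
by rewrite natrD !natrX.
Qed.

Let v_bound t : ip (v t) (v t) <= (weight t)%:R.
Proof. by rewrite /v; case: ifP => _; rewrite ?normal_norm2 ?ip0l. Qed.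

(** The [len] steps of a block, with error [2 / len^2] each, then cost [2 / len] together. *)
Let precision (t : T) : nat := len t.1 ^ 2.

Lemma block_operators : exists A B C : H -> H,
  [/\ orthogonal_projection ip A, orthogonal_projection ip B &
      orthogonal_projection ip C] /\
  exists r s : T -> nat, (forall t, 0 < r t)%N /\ (forall t, 0 < s t)%N /\
    (forall t x y, `|iter (r t) (compression A B C (s t)) x -
      iter (r t) (compression A B C (s t)) y| <= `|x - y|) /\
    forall t x, (t.2 < len t.1)%N ->
      (exists a c, x = a *: e t.1 + c *: e t.1.+1) ->
      `|iter (r t) (compression A B C (s t)) x - reject ip x (normal t)| <=
      2 / (len t.1)%:R ^+ 2 * `|x|.
Proof.
(* The order of choices is [M], then [L], whose tolerances involve [M], then [sigma], whose growth
   involves [L]. *)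
have slack_bound t : exists m : nat, lift_slack (ip := ip) b v neighbours t <= m%:R.
  have [m mP] := monotone_cauchy_archimedean mcK
    (lift_slack (ip := ip) b v neighbours t).
  by exists m; apply: le_trans mP; rewrite ger0_norm // (ip_self_ge0 ip_norm).
have [M M_bound] := choice slack_bound.
pose U := neighbours.
pose tol l t := (precision t * size (U t) *
  (2 * precision t * (l ^ 2 + M t)))%N.
have [L [L_gt1 L_large]] := earlier_recursion (fun u t l => tol l t * weight u)%N.
have [sigma [sigma_gt1 sigma_large]] :=
  later_recursion (fun u t l => l ^ 2 * (tol (L t) t * weight u))%N.
have [|A projA] := perp_proj_exists ip_norm mcK (f := base b).
  move=> i j ij; rewrite b_orth (_ : _ == _ = false) //; apply: contraNF ij => /eqP.
  by case: i j => [?|?] [?|?] //= [->].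
have [|B projB] := perp_proj_exists ip_norm mcK (f := tilt b).
  by move=> s t /negbTE st; rewrite b_orth -[_ == _]/(s == t) st.
have [|C projC] := perp_proj_exists ip_norm mcK (f := tilted (ip := ip) b v U L sigma).
  by apply: tilted_orth => // t; apply: undup_uniq.
exists A, B, C; split.
  by split; apply: (perp_proj_orthogonal_projection ip_norm); eassumption.
exists (power L precision M), (fun t => sigma t ^ 2)%N; split.
  by move=> t; rewrite !muln_gt0 !expn_gt0 addn_gt0 expn_gt0 /= (ltnW (L_gt1 t)).
split=> [t|]; first by rewrite expn_gt0 (ltnW (sigma_gt1 t)).
split=> [t x y|t x tlen xP].
  elim: (power _ _ _ _) => //= r; apply: le_trans.
  rewrite -(compressionB ip_norm projA projB projC).
  exact: (compression_le ip_norm projA projB projC).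
have vE : v t = normal t by rewrite /v tlen.
rewrite -vE -natrX.
pose P y := exists a c, y = a *: e t.1 + c *: e t.1.+1.
have P_b y : P y -> forall i, ip y (b i) = 0.
  by move=> [a [c ->]] i; rewrite ipDl !ipZl !e_b !mulr0 addr0.
have P_stable y a : P y -> P (y + a *: v t).
  move=> [a1 [c1 ->]]; rewrite vE /normal /path_normal scalerDr !scalerA.
  by rewrite addrACA -!scalerDl; do 2!eexists.
have P_v y u : P y -> u != t ->
    ip y (v u) = 0 \/ u \in U t /\ earlier u t || earlier t u.
  move=> [a [c yE]] ut.
  have [ulen|ulen] := ltnP u.2 (len u.1); last by left; rewrite /v ltnNge ulen ip0r.
  have [adj|far] := boolP [|| u.1 == t.1, u.1 == t.1.+1 | t.1 == u.1.+1]; last first.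
    move: far; rewrite !negb_or => /and3P[u0 u1 u2].
    left; apply: v_far; rewrite yE ipDl !ipZl !e_orth.
      by rewrite !(eq_sym _ u.1) (negbTE u0) (negbTE u1) !mulr0 addr0.
    by rewrite (negbTE u2) eqSS eq_sym (negbTE u0) !mulr0 addr0.
  right; split.
    rewrite mem_undup inE mem_near ulen andbT.
    by case/or3P: adj => /eqP E1;
      rewrite ?E1 ?ltnS ?leqnn ?leqW ?orbT // -E1 leqW ?orbT.
  (* Within a block the positions decide the order; adjacent blocks have opposite parities, and the
     even one comes first. *)
  rewrite /earlier ulen tlen /=; case/or3P: adj => /eqP E1.
  - rewrite E1 eqxx /=; have [//|/=|E2] := ltngtP u.2 t.2; first by rewrite orbT.
    by move: ut; rewrite -pair_eqE /pair_eq E1 E2 !eqxx.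
  - by rewrite E1 eqxx /= !orbT !andbT; case: (odd t.1); rewrite ?orbT.
  - by rewrite E1 eqxx /= !orbT !andbT; case: (odd u.1); rewrite ?orbT.
apply: (compression_power ip_norm b_orth v_b v_real _ U_orth L_gt1 projA projB projC
  (prec := earlier) (V := weight) _ _ sigma_gt1 v_bound M_bound
  _ _ P_b P_stable P_v) => //.
- by move=> w; apply: undup_uniq.
- by move=> w; rewrite expn_gt0 block_length_gt0.
- by move=> w; rewrite mem_undup inE eqxx.
- by move=> w u _; apply: L_large.
- by move=> w u _; apply: sigma_large.
- by rewrite vE normal_norm2 ler1n addn_gt0 expn_gt0 orbT.
Qed.

Lemma divergent_product : has_divergent_product_of_three_projections ip.
Proof.
have [A [B [C [proj [r [s [r_gt0 [s_gt0 [F_lip F_approx]]]]]]]]] := block_operators.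
pose F t := iter (r t) (compression A B C (s t)).
pose G n := iteri (len n) (fun j => F (n, j)).
have iteri_lip n (f : nat -> H -> H) x y :
    (forall i x y, `|f i x - f i y| <= `|x - y|) ->
    `|iteri n f x - iteri n f y| <= `|x - y|.
  by move=> f_lip; elim: n => //= n; apply: le_trans.
have G_lip n x y : `|G n x - G n y| <= `|x - y|.
  by apply: iteri_lip => i; apply: F_lip.
have len_gt0 n : 0 < (len n)%:R :> K by rewrite ltr0n block_length_gt0.
have G_end n : `|G n (e n) - e n.+1| <= 6 / (len n)%:R.
  have [en en1 enn1] : [/\ ip (e n) (e n) = 1, ip (e n.+1) (e n.+1) = 1 &
      ip (e n) (e n.+1) = 0] by rewrite !e_orth !eqxx ltn_eqF.
  pose x j := iteri j (fun i x => reject ip x (normal (n, i))) (e n).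
  (* The errors of the steps only add up, since every [F] is nonexpansive and the exact path stays
     in the unit ball. *)
  have F_path j : (j <= len n)%N ->
      `|iteri j (fun j => F (n, j)) (e n) - x j| <= j%:R * (2 / (len n)%:R ^+ 2).
    elim: j => [_|j IHj lt_j]; first by rewrite subrr normr0 mul0r.
    rewrite /x !iteriS -/(x j) (le_trans (ler_distD (F (n, j) (x j)) _ _)) //.
    rewrite mulrSr mulrDl mul1r lerD //.
      by rewrite (le_trans (F_lip _ _ _)) // IHj // ltnW.
    have [lambda [_ xE _]] :=
      rejects_path en en1 enn1 (block_length_gt0 n) (ltnW lt_j).
    have x1 : `|x j| <= 1 := rejects_path_le ip_norm (e n.+1) en (ltnW lt_j).
    have xP : exists a c, x j = a *: e (n, j).1 + c *: e (n, j).1.+1.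
      by rewrite [x j]xE scalerDr !scalerA; do 2!eexists.
    rewrite (le_trans (F_approx (n, j) (x j) lt_j xP)) //.
    by rewrite ler_piMr // divr_ge0 // exprn_ge0 // ltW.
  rewrite (le_trans (ler_distD (x (len n)) _ _)) //.
  have -> : 6 / (len n)%:R =
      (len n)%:R * (2 / (len n)%:R ^+ 2) + 4 / (len n)%:R :> K.
    by field; rewrite gt_eqF.
  rewrite lerD ?F_path //.
  exact (rejects_path_end ip_norm en en1 enn1 (block_length_gt0 n)).
pose Z n := iteri n G (e 0).
(* The bound is the partial sum of the block costs [6 / 2^(n + 6)]. *)
have Z_close n : `|Z n - e n| <= 3 / 16 * (1 - 2^-1 ^+ n).
  elim: n => [|n IHn]; first by rewrite subrr normr0 expr0 subrr mulr0.
  rewrite /Z iteriS -/(Z n) (le_trans (ler_distD (G n (e n)) _ _)) //.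
  rewrite (le_trans (lerD (le_trans (G_lip n _ _) IHn) (G_end n))) //.
  rewrite /block_length expnD natrM !natrX -subr_ge0 (_ : _ - _ = 0) //.
  by rewrite exprS !exprVn; field; rewrite expf_neq0.
have Z_near n : `|Z n - e n| <= 4^-1.
  rewrite (le_trans (Z_close n)) // (_ : 4^-1 = 4 / 16); last by field.
  rewrite (@le_trans _ _ (3 / 16)) ?ler_wpM2r ?ler_nat //.
  by rewrite ler_piMr // gerBl exprn_ge0 // invr_ge0.
(* Consecutive vertices are at distance at least 1, and each [Z n] is within [1 / 4] of its
   vertex. *)
have Z_jump n : 2^-1 <= `|Z n - Z n.+1|.
  have e_jump : 1 <= `|e n - e n.+1|.
    rewrite -(@ler_pXn2r _ 2) ?nnegrE // ip_norm expr1n ipBl !ipBr !e_orth !eqxx.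
    by rewrite ltn_eqF // gtn_eqF // sub0r subr0 opprK lerDl.
  rewrite -(lerD2r 2^-1) -[X in X <= _](_ : 1 = _); last by field.
  rewrite (le_trans e_jump) // (le_trans (ler_distD (Z n) _ _)) //.
  rewrite (le_trans (lerD (lexx _) (ler_distD (Z n.+1) _ _))) //.
  rewrite addrCA lerD2l (_ : 2^-1 = 4^-1 + 4^-1); last by field.
  by rewrite lerD // distrC.
have G_word n : is_word (fun f => [\/ f = A, f = B | f = C]) (G n).
  have wA : is_word (fun f => [\/ f = A, f = B | f = C]) A.
    by apply: word_letter; constructor 1.
  have wB : is_word (fun f => [\/ f = A, f = B | f = C]) B.
    by apply: word_letter; constructor 2.
  have wC : is_word (fun f => [\/ f = A, f = B | f = C]) C.
    by apply: word_letter; constructor 3.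
  apply: word_iteri => [i _|]; last exact: block_length_gt0.
  apply: word_iter => //; apply: word_ext (word_comp wA _) => //.
  exact: word_iter (word_comp wB wC) _.
have [P [P_letter [N [N_ge PN]]]] := words_concatenation G_word.
exists A, B, C; split=> //; exists P, (e 0); split=> // P_cvg.
have [l lP] := (cvg_ex _).1 P_cvg.
have [M _ MP] := (cvgrPdist_lt _ l).1 lP 4^-1 ltac:(by rewrite invr_gt0).
have close n : (M < n)%N -> `|l - Z n| < 4^-1.
  move=> ltMn; have := leq_trans ltMn (N_ge n).
  rewrite /Z -PN; case: (N n) => // m leMm; exact: MP.
have : `|Z M.+1 - Z M.+2| < 2^-1.
  rewrite (le_lt_trans (ler_distD l _ _)) // (_ : 2^-1 = 4^-1 + 4^-1); last by field.
  by rewrite ltrD ?[`|Z _ - l|]distrC ?close.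
by move/(le_lt_trans (Z_jump M.+1)); rewrite ltxx.
Qed.

End Construction.

(** * The real and complex scalar fields *)

Lemma real_monotone_cauchy (R : realType) : monotone_cauchy R.
Proof.
move=> u u_ge0 u_dec e e0.
have u_cvg : cvgn u.
  apply: nonincreasing_is_cvgn; first by apply/nonincreasing_seqP.
  by exists 0 => _ [n _ <-].
have [N _ uN] := (cvgrPdist_lt _ _).1 u_cvg (e / 2) (divr_gt0 e0 (ltr0Sn _ 1)).
exists N => m leNm.
rewrite [e]splitr (le_lt_trans (ler_distD (limn u) _ _)) //.
by rewrite ltrD //; [rewrite distrC; apply: uN => /=|apply: uN].
Qed.

Lemma complex_monotone_cauchy (R : realType) : monotone_cauchy R[i].
Proof.
move=> u u_ge0 u_dec e; rewrite ltcE /= => /andP[/eqP ime e0].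
have imu n : complex.Im (u n) = 0.
  by have := u_ge0 n; rewrite lecE /= => /andP[/eqP].
have [n|n|N uN] := @real_monotone_cauchy R (fun n => complex.Re (u n)) _ _ _ e0.
- by have := u_ge0 n; rewrite lecE /= => /andP[_].
- by have := u_dec n; rewrite lecE /= => /andP[_].
exists N => m leNm; have := uN m leNm.
have -> : u N - u m = (complex.Re (u N) - complex.Re (u m))%:C%C.
  apply/eqP; rewrite eq_complex; move: (imu N) (imu m).
  by case: (u N) (u m) => a b [c d] /= -> ->; rewrite subrr !eqxx.
rewrite normc_def /= expr0n addr0 sqrtr_sqr ltcE /= ime eqxx.
by [].
Qed.

Theorem theorem1p1 (R : realType) :
  (forall (H : completeNormedModType R) (ip : {dot H for idfun}),
     induces_norm ip -> ~ finite_dimensional H ->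
     has_divergent_product_of_three_projections ip) /\
  (forall (H : completeNormedModType R[i]) (ip : {dot H for Num.conj}),
     induces_norm ip -> ~ finite_dimensional H ->
     has_divergent_product_of_three_projections ip).
Proof.
split=> H ip ip_norm infH.
  have mcR := @real_monotone_cauchy R.
  have [E E_orth] := @orthonormal_sequence R idfun H ip ip_norm infH.
  exact (@divergent_product R idfun H ip ip_norm mcR E E_orth).
have mcR := @complex_monotone_cauchy R.
have [E E_orth] := @orthonormal_sequence R[i] Num.conj H ip ip_norm infH.
exact (@divergent_product R[i] Num.conj H ip ip_norm mcR E E_orth).
Qed.
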